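(* Let $R$ be a semiprimitive commutative ring with identity and let $M\in\mathrm{Max}(R)$. The following statements are equivalent. (a) $M$ is an isolated point of $\mathrm{Max}(R)$. (b) $M$ cannot be omitted in $\bigcap\mathrm{Max}(R)$; that is, $\bigcap_{M\neq N\in\mathrm{Max}(R)}N\neq\bigcap_{N\in\mathrm{Max}(R)}N$. (c) $M=\mathrm{Ann}(x)$ for some $x\in R$. (d) $M\in\mathcal{B}(R)$.
   Context: $\mathrm{Max}(R)$ is the set of maximal ideals of $R$ with the Zariski (hull-kernel) topology, whose closed sets are the sets $h_M(S)=\{M\in\mathrm{Max}(R): S\subseteq M\}$ for $S\subseteq R$. $R$ is semiprimitive if the intersection of all its maximal ideals is $\{0\}$. $\mathrm{Ann}(x)=\{r\in R: rx=0\}$. $\mathrm{Min}(R)$ is the set of minimal prime ideals of $R$. A prime ideal $P_0\in\mathrm{Min}(R)$ is a Bourbaki associated prime divisor of $R$ if $\sqrt{\{0\}}\neq\bigcap_{P_0\neq P\in\mathrm{Min}(R)}P$; $\mathcal{B}(R)$ is the set of all Bourbaki associated prime divisors of $R$. The intersection of the empty family of ideals of $R$ is $R$. *)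

(* Defs.v *)
From HB Require Import structures.
From mathcomp Require Import all_boot all_order all_algebra ring_quotient.
From mathcomp Require Import ring.
From mathcomp Require Import all_classical topology.

Set Implicit Arguments.
Unset Strict Implicit.
Unset Printing Implicit Defensive.
Import GRing.Theory.
Local Open Scope classical_set_scope.
Local Open Scope ring_scope.

Section Ideals.
Variable R : comNzRingType.
Implicit Types I J P S : set R.

(* [idealr_closed] includes [1 \notin I]: proper ideals only. *)
Definition is_proper_ideal I := idealr_closed [in I].

Definition is_prime_ideal I := is_proper_ideal I /\ prime_idealr_closed [in I].

Definition is_maximal_ideal I :=
  is_proper_ideal I /\ forall J, is_proper_ideal J -> I `<=` J -> J = I.

Definition is_minimal_prime I :=
  is_prime_ideal I /\ forall J, is_prime_ideal J -> J `<=` I -> J = I.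

Definition maximal_ideals : set (set R) := [set I | is_maximal_ideal I].

Definition minimal_primes : set (set R) := [set I | is_minimal_prime I].

Definition semiprimitive := \bigcap_(N in maximal_ideals) N = [set 0].

Definition Ann (x : R) : set R := [set r | r * x = 0].

Definition radical I : set R := [set x | exists n, I (x ^+ n.+1)].

(* An intersection over an empty index set is [setT], that is, all of R. *)
Definition bourbaki_primes : set (set R) :=
  [set P0 | minimal_primes P0 /\
            radical [set 0] <> \bigcap_(P in minimal_primes `\ P0) P].

Definition maxspec : Type := set_type maximal_ideals.

HB.instance Definition _ := Choice.on maxspec.

Definition max_ideal (M : maxspec) : set R := set_val M.

Definition hull S : set maxspec := [set M | S `<=` max_ideal M].

Lemma max_idealP (M : maxspec) : is_maximal_ideal (max_ideal M).
Proof. by have /set_mem := valP M. Qed.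

Lemma proper_idealE I : is_proper_ideal I <->
  [/\ I 0, ~ I 1 & forall a u v, I u -> I v -> I (a * u + v)].
Proof.
split=> [[I0 I1 IM]|[I0 I1 IM]]; split.
- exact: set_mem I0.
- by move=> /mem_set I1'; move/negP: I1; apply.
- by move=> a u v /mem_set Iu /mem_set Iv; exact: set_mem (IM a u v Iu Iv).
- exact: mem_set.
- by apply/negP => /set_mem.
- by move=> a u v /set_mem Iu /set_mem Iv; apply: mem_set; exact: IM.
Qed.

Lemma maximal_ideal_prime I a b :
  is_maximal_ideal I -> I (a * b) -> I a \/ I b.
Proof.
move=> [/proper_idealE[I0 I1 IM] Imax] Iab.
pose J := [set y | exists m r, I m /\ y = m + r * a].
have [J1|J1] := pselect (J 1); [right|left].
  have [m [r [Im e]]] := J1.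
  have -> : b = b * m + (r * (a * b) + 0) by rewrite -[LHS]mulr1 e; ring.
  by apply: (IM) => //; apply: IM.
have IJ : I `<=` J by move=> m Im; exists m, 0; rewrite mul0r addr0.
rewrite -(Imax J) //; first by exists 0, 1; rewrite add0r mul1r.
apply/proper_idealE; split=> //; first exact: IJ.
move=> c u v [m [r [Im ->]]] [m' [r' [Im' ->]]].
exists (c * m + m'), (c * r + r'); split; first exact: IM.
by ring.
Qed.

Definition zariski_open : set_system maxspec := [set U | exists S, U = ~` hull S].

Lemma zariski_openT : zariski_open setT.
Proof.
exists [set 1]; apply/seteqP; split=> // M _ /(_ 1 erefl).
by have [/proper_idealE[]] := max_idealP M.
Qed.

Lemma zariski_openI : setI_closed zariski_open.
Proof.
move=> _ _ [S ->] [S' ->].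
exists [set x | exists s s', [/\ S s, S' s' & x = s * s']].
rewrite -setCU; congr (~` _); apply/seteqP; split=> M /=.
  have [/proper_idealE[M0 _ MM] _] := max_idealP M.
  case=> sM _ [s [s' [Ss Ss' ->]]]; last first.
    by rewrite -[_ * _]addr0; apply: MM => //; exact: sM.
  by rewrite mulrC -[_ * _]addr0; apply: MM => //; exact: sM.
move=> sM; have [|nS] := pselect (S `<=` max_ideal M); [by left | right].
have [s [Ss nMs]] : exists s, S s /\ ~ max_ideal M s.
  by move/nonsubset: nS => [s []]; exists s.
move=> s' Ss'; have Mss' : max_ideal M (s * s') by apply: sM; exists s, s'.
by have [] := maximal_ideal_prime (max_idealP M) Mss'.
Qed.

Lemma zariski_open_bigU (K : Type) (f : K -> set maxspec) :
  (forall i, zariski_open (f i)) -> zariski_open (\bigcup_i f i).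
Proof.
move=> /choice[S fS]; exists (\bigcup_i S i).
rewrite -[LHS]setCK setC_bigcup; congr (~` _); apply/seteqP; split=> M /=.
  by move=> h s [i _ Sis]; have := h i I; rewrite fS setCK; exact.
by move=> h i _; rewrite fS setCK => s Sis; apply: h; exists i.
Qed.

HB.instance Definition _ := isOpenTopological.Build maxspec
  zariski_openT zariski_openI zariski_open_bigU.

Lemma zariski_closedP (A : set maxspec) : closed A <-> exists S, A = hull S.
Proof.
rewrite -openC; split=> [[S /(congr1 setC)]|[S ->]]; last by exists S.
by rewrite !setCK; exists S.
Qed.

End Ideals.

Arguments maximal_ideals : clear implicits.
Arguments minimal_primes : clear implicits.
Arguments bourbaki_primes : clear implicits.
Arguments semiprimitive : clear implicits.
Arguments maxspec : clear implicits.

(* Main.v *)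
Require Import Defs.
From mathcomp Require Import all_boot all_order all_algebra.
From mathcomp Require Import all_classical topology.

(** All four conditions say that some [x <> 0] lies in every maximal ideal other
than [M]. Semiprimitivity then gives [~ M x], which makes [{M}] the complement
of the hull of [x], and it gives [m * x = 0] for every [m] in [M], because
[m * x] lies in all maximal ideals. So [M] is contained in the proper ideal
[Ann x] and is equal to it by maximality.

Minimal primes enter through the relation [M * x = 0]. A prime [P] always
contains one of the factors: if it contains [M], it is [M]; otherwise it
contains [x]. Since a semiprimitive ring is reduced, [M = Ann x] forces
[~ M x], so [M] is a minimal prime, and [x] is a non-nilpotent element of all
the other minimal primes ([Ann_maximal_minimal_prime], [Ann_maximal_prime]).
In the opposite direction, every maximal ideal [N <> M] contains a minimal prime
([exists_minimal_prime_sub]), which is not [M]; hence an element of all minimal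
primes other than [M] lies in all maximal ideals other than [M]. *)

Import GRing.Theory.
Local Open Scope classical_set_scope.
Local Open Scope ring_scope.

(** * Proper and prime ideals *)

Lemma proper_idealM (R : comNzRingType) (I : set R) (a u : R) :
  is_proper_ideal I -> I u -> I (a * u).
Proof.
by move=> /proper_idealE[I0 _ IM] Iu; rewrite -[_ * _]addr0; exact: IM.
Qed.

Lemma prime_idealE (R : comNzRingType) (I : set R) :
  is_prime_ideal I <->
  is_proper_ideal I /\ forall a b, I (a * b) -> I a \/ I b.
Proof.
split=> -[Iproper Iprime]; split=> // a b.
- by move=> /mem_set/Iprime/orP[] /set_mem; [left | right].
- by move=> /set_mem/Iprime[] /mem_set ->; rewrite ?orbT.
Qed.

Lemma maximal_ideal_is_prime (R : comNzRingType) (I : set R) :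
  is_maximal_ideal I -> is_prime_ideal I.
Proof.
move=> Imax; apply/prime_idealE; split=> [|a b]; first by case: Imax.
exact: maximal_ideal_prime.
Qed.

Lemma prime_idealX (R : comNzRingType) (P : set R) (x : R) (n : nat) :
  is_prime_ideal P -> P (x ^+ n.+1) -> P x.
Proof.
move=> /prime_idealE[_ Pprime]; elim: n => [|n IHn]; first by rewrite expr1.
by rewrite exprS => /Pprime[].
Qed.

(** In a semiprimitive ring, both the intersection of all maximal ideals and the
radical of [set 0] are zero. So both intersection conditions, the one on maximal
ideals and the one on minimal primes, state that an intersection of proper
ideals is not the zero ideal; this lemma extracts a witness. *)
Lemma bigcap_ideal_neq0 (R : comNzRingType) (F : set (set R)) :
  F `<=` @is_proper_ideal R -> \bigcap_(I in F) I <> [set 0] ->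
  exists2 x, x <> 0 & forall I, F I -> I x.
Proof.
move=> Fproper F0; apply: contrapT => nox; apply/F0/seteqP; split=> [x Fx|_ ->].
- by apply: contrapT => x0; apply: nox; exists x.
- by move=> I /Fproper/proper_idealE[].
Qed.

Lemma Ann_proper_ideal (R : comNzRingType) (x : R) :
  x <> 0 -> is_proper_ideal (Ann x).
Proof.
move=> x0; apply/proper_idealE; split; rewrite /Ann /=.
- exact: mul0r.
- by rewrite mul1r.
- by move=> a u v ux vx; rewrite mulrDl -mulrA ux vx mulr0 addr0.
Qed.

(** * Minimal primes *)

(** If [a * b] is in the intersection but [a] misses the member [P] and [b]
misses the member [Q], then the smaller of [P] and [Q] contains neither factor,
although it is prime. *)
Lemma bigcap_chain_prime (R : comNzRingType) (F : set (set R)) :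
  F !=set0 -> F `<=` @is_prime_ideal R -> total_on F subset ->
  is_prime_ideal (\bigcap_(P in F) P).
Proof.
move=> [P0 FP0] Fprime Ftot; apply/prime_idealE; split.
  apply/proper_idealE; split.
  - by move=> P /Fprime[/proper_idealE[]].
  - by move=> /(_ P0 FP0); case: (Fprime _ FP0) => /proper_idealE[].
  - move=> a u v Fu Fv P FP; have [/proper_idealE[_ _ PM] _] := Fprime _ FP.
    by apply: PM; [exact: Fu | exact: Fv].
move=> a b Fab; apply: contrapT => /not_orP[].
move=> /existsNP[P /not_implyP[FP Pa]] /existsNP[Q /not_implyP[FQ Qb]].
have /prime_idealE[_ Pprime] := Fprime _ FP.
have /prime_idealE[_ Qprime] := Fprime _ FQ.
have [PQ|QP] := Ftot P Q FP FQ.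
- by have [//|/PQ] := Pprime _ _ (Fab P FP).
- by have [/QP|] := Qprime _ _ (Fab Q FQ).
Qed.

(** Zorn's lemma is applied to the sets [C] such that [N `\` C] is prime: unions
of such [C] correspond to intersections of primes, and a maximal [C] leaves a
minimal prime. *)
Lemma exists_minimal_prime_sub (R : comNzRingType) (N : set R) :
  is_prime_ideal N -> exists2 P, is_minimal_prime P & P `<=` N.
Proof.
move=> Nprime.
have [F FP Ftot|A [NAprime Amax]] :=
    @Zorn_bigcup R [set C | is_prime_ideal (N `\` C)].
  rewrite /=; have [->|F0] := eqVneq F set0.
    by rewrite bigcup_set0 setD0.
  rewrite -bigcupDr; last exact/set0P.
  rewrite -(bigcap_image F (fun X => N `\` X) id).
  apply: bigcap_chain_prime.
  - by have /set0P[X FX] := F0; exists (N `\` X), X.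
  - by move=> _ [X FX <-]; exact: FP.
  - move=> _ _ [X FX <-] [Y FY <-].
    by have [XY|YX] := Ftot X Y FX FY; [right | left]; exact: setDS.
exists (N `\` A); last exact: subDsetl.
split=> // J Jprime JNA; apply/seteqP; split=> // y [Ny Ay].
apply: contrapT => Jy; apply: (Amax (~` J)); last first.
  by rewrite /= setDE setCK setIidr // => z /JNA[].
by split=> [z Az /JNA[]//|/(_ y Jy)].
Qed.

(** * Maximal ideals that are annihilators *)

Lemma Ann_maximal_prime (R : comNzRingType) (x : R) (P : set R) :
  is_maximal_ideal (Ann x) -> is_prime_ideal P -> P <> Ann x -> P x.
Proof.
move=> [_ Amax] /prime_idealE[Pproper Pprime] PA; apply: contrapT => Px.
apply/PA/Amax => // m mx0.
have [] // := Pprime m x.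
by rewrite (mx0 : m * x = 0); case/proper_idealE: Pproper.
Qed.

Lemma Ann_maximal_minimal_prime (R : comNzRingType) (x : R) :
  is_maximal_ideal (Ann x) -> x * x <> 0 -> is_minimal_prime (Ann x).
Proof.
move=> Amax xx; split=> [|J Jprime JA]; first exact: maximal_ideal_is_prime.
by apply: contrapT => /(Ann_maximal_prime _ _ _ Amax Jprime)/JA.
Qed.

(** * Semiprimitive rings *)

Lemma semiprimitive_eq0 (R : comNzRingType) (x : R) :
  semiprimitive R -> (forall N, is_maximal_ideal N -> N x) -> x = 0.
Proof. by move=> hR Nx; rewrite -[_ = _]/([set 0] x) -hR. Qed.

Lemma semiprimitive_reduced (R : comNzRingType) (x : R) (n : nat) :
  semiprimitive R -> x ^+ n.+1 = 0 -> x = 0.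
Proof.
move=> hR xn0; apply: semiprimitive_eq0 => // N Nmax.
apply: (@prime_idealX _ _ _ n); first exact: maximal_ideal_is_prime.
by rewrite xn0; have [/proper_idealE[]] := Nmax.
Qed.

Lemma semiprimitive_radical0 (R : comNzRingType) :
  semiprimitive R -> radical [set 0 : R] = [set 0].
Proof.
move=> hR; apply/seteqP; split=> [x [n]|x ->].
- exact: semiprimitive_reduced.
- by exists 0; rewrite expr1.
Qed.

Lemma semiprimitive_maximal_Ann (R : comNzRingType) (M : set R) (x : R) :
  semiprimitive R -> is_maximal_ideal M -> x <> 0 ->
  (forall N, is_maximal_ideal N -> N <> M -> N x) -> M = Ann x.
Proof.
move=> hR [Mproper Mmax] x0 Nx; apply/esym/Mmax; first exact: Ann_proper_ideal.
move=> m Mm; apply: semiprimitive_eq0 => // N Nmax.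
have [->|/eqP NM] := eqVneq N M.
- by rewrite mulrC; exact: proper_idealM.
- by apply: proper_idealM (Nx _ Nmax NM); case: Nmax.
Qed.

(** * Isolated points of the maximal spectrum *)

(** The complements of the hulls of single elements form a basis of open sets,
so [{M}] is open exactly when it is such a complement. *)
Lemma maxspec_isolatedP (R : comNzRingType) (M : maxspec R) :
  isolated [set: maxspec R] M <->
  exists2 x, ~ max_ideal M x &
    forall N, is_maximal_ideal N -> N <> max_ideal M -> N x.
Proof.
split=> [[_ [V + VM]]|[x Mx Nx]].
  rewrite nbhsE => -[U [[S US] UM] UV].
  have [x [Sx Mx]] : exists x, S x /\ ~ max_ideal M x.
    by move: UM; rewrite US => /nonsubset[x []]; exists x.
  exists x => // N Nmax NM; apply: contrapT => Nx.
  pose N' : maxspec R := exist _ N (mem_set Nmax).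
  have : (V `&` setT) N' by split=> //; apply: UV; rewrite US => /(_ x Sx).
  by rewrite VM => N'M; apply: NM; rewrite -N'M.
split; first exact: in_setT.
exists (~` hull [set x]).
  apply: open_nbhs_nbhs; split; first by exists [set x].
  by move=> /(_ x erefl).
rewrite setIT; apply/seteqP; split=> [N xN|N ->]; last by move=> /(_ x erefl).
apply: contrapT => NM; apply: xN => _ ->; apply: Nx; first exact: max_idealP.
by move=> NM'; apply/NM/val_inj.
Qed.

Theorem theorem4p4 (R : comNzRingType) (hR : semiprimitive R)
    (M : maxspec R) :
  [<-> isolated [set: maxspec R] M;
       \bigcap_(N in maximal_ideals R `\ max_ideal M) N <>
         \bigcap_(N in maximal_ideals R) N;
       exists x : R, max_ideal M = Ann x;
       bourbaki_primes R (max_ideal M)].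
Proof.
have Mmax := max_idealP M.
tfae.
- move=> /maxspec_isolatedP[x Mx Nx] eqcap; apply: Mx.
  suff: (\bigcap_(N in maximal_ideals R) N) x by apply.
  by rewrite -eqcap => N [Nmax NM]; exact: Nx.
- rewrite hR => /bigcap_ideal_neq0[N [[]]//|x x0 Nx]; exists x.
  by apply: semiprimitive_maximal_Ann => // N Nmax NM; exact: Nx.
- move=> [x Mx]; rewrite Mx in Mmax *.
  have x0 : x <> 0.
    by case: Mmax => /proper_idealE[_ A1 _] _ x0; apply: A1;
      rewrite x0 /Ann /= mulr0.
  split.
    apply: Ann_maximal_minimal_prime => //; rewrite -expr2.
    by move=> /(semiprimitive_reduced _ _ _ hR).
  rewrite semiprimitive_radical0 // => cap0; apply: x0.
  rewrite -[_ = _]/([set 0] x) cap0 => P [[Pprime _] PM].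
  exact: Ann_maximal_prime.
- move=> [_]; rewrite semiprimitive_radical0 // => /nesym/bigcap_ideal_neq0.
  case=> [P [[[]]]//|x x0 Px].
  have Nx N : is_maximal_ideal N -> N <> max_ideal M -> N x.
    move=> Nmax NM.
    have Nprime := maximal_ideal_is_prime _ _ Nmax.
    have [P Pmin PN] := exists_minimal_prime_sub _ _ Nprime.
    apply/PN/(Px P); split=> // PM; apply: NM.
    by case: Mmax => _; apply; [case: Nmax | rewrite -PM].
  apply/maxspec_isolatedP; exists x => // Mx; apply: x0.
  apply: semiprimitive_eq0 => // N Nmax.
  by have [->|/eqP] := eqVneq N (max_ideal M); last exact: Nx.
Qed.
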